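(* Let $H$ be a cocommutative Hopf algebra over a field $k$ and let $A$ be a commutative symmetric twisted partial $H$-module algebra. Then $A$ is a partial $H$-module algebra.
   Context: Sweedler notation is used; $\epsilon$ is the counit of $H$; $A$ is a unital $k$-algebra. A partial action of $H$ on $A$ (making $A$ a partial $H$-module algebra) is a linear map $\cdot:H\otimes A\to A$ such that for all $a,b\in A$, $h,l\in H$: (PA1) $1_H\cdot a=a$; (PA2) $h\cdot(ab)=(h_{(1)}\cdot a)(h_{(2)}\cdot b)$; (PA3) $h\cdot(l\cdot a)=(h_{(1)}\cdot 1_A)(h_{(2)}l\cdot a)$. A twisted partial action of $H$ on $A$ is a pair of linear maps $\cdot:H\otimes A\to A$ and $\omega:H\otimes H\to A$ such that for all $h,l\in H$, $a,b\in A$: (TPA1) $1_H\cdot a=a$; (TPA2) $h\cdot(ab)=(h_{(1)}\cdot a)(h_{(2)}\cdot b)$; (TPA3) $(h_{(1)}\cdot(l_{(1)}\cdot a))\,\omega(h_{(2)},l_{(2)})=\omega(h_{(1)},l_{(1)})\,(h_{(2)}l_{(2)}\cdot a)$; (TPA4) $\omega(h,l)=\omega(h_{(1)},l_{(1)})\,(h_{(2)}l_{(2)}\cdot1_A)$. Then $(A,\cdot,\omega)$ is called a twisted partial $H$-module algebra. It is symmetric if: (i) the maps $\tilde e_{1,2},\tilde e_2:H\otimes H\to A$, $\tilde e_{1,2}(h,l)=(h\cdot1_A)\epsilon(l)$, $\tilde e_2(h,l)=hl\cdot1_A$, are central idempotents in the convolution algebra $\mathrm{Hom}_k(H\otimes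 H,A)$; (ii) $\omega$ satisfies $(h_{(1)}\cdot\omega(l_{(1)},m_{(1)}))\,\omega(h_{(2)},l_{(2)}m_{(2)})=\omega(h_{(1)},l_{(1)})\,\omega(h_{(2)}l_{(2)},m)$ for all $h,l,m\in H$, and is an invertible element of the ideal $\langle\tilde e_{1,2}*\tilde e_2\rangle\subset\mathrm{Hom}_k(H\otimes H,A)$ (whose unit is $\tilde e_{1,2}*\tilde e_2$); (iii) for all $h,l\in H$, $h\cdot(l\cdot1_A)=(h_{(1)}\cdot1_A)(h_{(2)}l\cdot1_A)$. The conclusion refers to the map $\cdot$ of the twisted partial action. *)

(* Defs.v *)
From HB Require Import structures.
From mathcomp Require Import all_boot all_algebra.
From mathcomp Require Import generic_quotient boolp.

Set Implicit Arguments.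
Unset Strict Implicit.
Unset Printing Implicit Defensive.

Import GRing.Theory.
Local Open Scope ring_scope.
Local Open Scope quotient_scope.

Notation bilin B := (bilinear_for *:%R *:%R B).

(* A list [:: (u1, v1); ...; (un, vn)] stands for the formal sum of the
   symbols u1 ⊗ v1, ..., un ⊗ vn, and two formal sums are identified when no
   bilinear map separates them.  The universal property is [tlift_tens],
   [tlift_linear] and [tlift_unique]. *)

Section TensorProduct.
Variables (k : fieldType) (U V : lmodType k).

Definition feval (W : lmodType k) (B : U -> V -> W) (s : seq (U * V)) : W :=
  \sum_(p <- s) B p.1 p.2.

Definition tens_eq (s t : seq (U * V)) : bool :=
  `[< forall (W : lmodType k) (B : U -> V -> W),
        bilin B -> feval B s = feval B t >].

Lemma tens_eq_refl : reflexive tens_eq.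
Proof. by move=> s; apply/asboolP. Qed.

Lemma tens_eq_sym : symmetric tens_eq.
Proof.
by move=> s t; apply/asboolP/asboolP => st W B /st.
Qed.

Lemma tens_eq_trans : transitive tens_eq.
Proof.
move=> t s r /asboolP st /asboolP tr; apply/asboolP => W B bB.
by rewrite st // tr.
Qed.

Canonical tens_equiv := EquivRel tens_eq tens_eq_refl tens_eq_sym tens_eq_trans.

Definition tensor : Type := {eq_quot tens_eq}.

HB.instance Definition _ := Choice.on tensor.

Definition tens (u : U) (v : V) : tensor := \pi_({eq_quot tens_eq}) [:: (u, v)].

(* Meaningful for bilinear [B] only: it is then the linear map on the tensor
   product that [B] factors through, and does not depend on [repr]. *)
Definition tlift (W : lmodType k) (B : U -> V -> W) (t : tensor) : W :=
  feval B (repr (t : {eq_quot tens_eq})).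

Let mk (s : seq (U * V)) : tensor := \pi_({eq_quot tens_eq}) s.

Lemma tlift_pi (W : lmodType k) (B : U -> V -> W) (s : seq (U * V)) :
  bilin B -> tlift B (\pi_({eq_quot tens_eq}) s) = feval B s.
Proof.
move=> bB; have /eqmodP/asboolP h : repr (\pi_({eq_quot tens_eq}) s) = s
  %[mod {eq_quot tens_eq}] by rewrite reprK.
exact: h.
Qed.

Lemma tensor_ext (x y : tensor) :
  (forall (W : lmodType k) (B : U -> V -> W),
     bilin B -> tlift B x = tlift B y) -> x = y.
Proof.
move=> h; rewrite -[x](@reprK _ {eq_quot tens_eq}).
rewrite -[y](@reprK _ {eq_quot tens_eq}).
by apply/eqmodP/asboolP => W B /h.
Qed.

Lemma tlift_tens (W : lmodType k) (B : U -> V -> W) (u : U) (v : V) :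
  bilin B -> tlift B (tens u v) = B u v.
Proof. by move=> bB; rewrite tlift_pi // /feval big_seq1. Qed.

Lemma bilinZl (W : lmodType k) (B : U -> V -> W) (a : k) (u : U) (v : V) :
  bilin B -> B (a *: u) v = a *: B u v.
Proof. by move=> bB; have := scalable_linear (bB.1 v) a u. Qed.

Definition tensor_zero : tensor := mk [::].
Definition tensor_add (x y : tensor) : tensor :=
  mk (repr (x : {eq_quot tens_eq}) ++ repr (y : {eq_quot tens_eq})).
Definition tensor_scale (a : k) (x : tensor) : tensor :=
  mk [seq (a *: p.1, p.2) | p <- repr (x : {eq_quot tens_eq})].

Lemma tlift0 (W : lmodType k) (B : U -> V -> W) :
  bilin B -> tlift B tensor_zero = 0.
Proof. by move=> bB; rewrite tlift_pi // /feval big_nil. Qed.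

Lemma tlift_add (W : lmodType k) (B : U -> V -> W) (x y : tensor) :
  bilin B -> tlift B (tensor_add x y) = tlift B x + tlift B y.
Proof. by move=> bB; rewrite tlift_pi // /feval big_cat. Qed.

Lemma tlift_scale (W : lmodType k) (B : U -> V -> W) (a : k) (x : tensor) :
  bilin B -> tlift B (tensor_scale a x) = a *: tlift B x.
Proof.
move=> bB; rewrite tlift_pi // /tlift /feval big_map scaler_sumr.
by apply: eq_bigr => p _ /=; rewrite bilinZl.
Qed.

Let tensorE := (tlift0, tlift_add, tlift_scale).

Lemma tensor_addA : associative tensor_add.
Proof. by move=> x y z; apply: tensor_ext => W B bB; rewrite !tensorE // addrA. Qed.

Lemma tensor_addC : commutative tensor_add.
Proof. by move=> x y; apply: tensor_ext => W B bB; rewrite !tensorE // addrC. Qed.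

Lemma tensor_add0 : left_id tensor_zero tensor_add.
Proof. by move=> x; apply: tensor_ext => W B bB; rewrite !tensorE // add0r. Qed.

Lemma tensor_addN : left_inverse tensor_zero (tensor_scale (-1)) tensor_add.
Proof.
by move=> x; apply: tensor_ext => W B bB; rewrite !tensorE // scaleN1r addNr.
Qed.

HB.instance Definition _ :=
  GRing.isZmodule.Build tensor tensor_addA tensor_addC tensor_add0 tensor_addN.

Lemma tensor_scaleA (a b : k) (x : tensor) :
  tensor_scale a (tensor_scale b x) = tensor_scale (a * b) x.
Proof. by apply: tensor_ext => W B bB; rewrite !tensorE // scalerA. Qed.

Lemma tensor_scale1 : left_id 1 tensor_scale.
Proof. by move=> x; apply: tensor_ext => W B bB; rewrite !tensorE // scale1r. Qed.

Lemma tensor_scaleDr : right_distributive tensor_scale +%R.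
Proof.
by move=> a x y; apply: tensor_ext => W B bB; rewrite !tensorE // scalerDr.
Qed.

Lemma tensor_scaleDl (x : tensor) :
  {morph tensor_scale^~ x : a b / a + b >-> a + b}.
Proof.
by move=> a b; apply: tensor_ext => W B bB; rewrite !tensorE // scalerDl.
Qed.

HB.instance Definition _ := GRing.Zmodule_isLmodule.Build k tensor
  tensor_scaleA tensor_scale1 tensor_scaleDr tensor_scaleDl.

Lemma tlift_linear (W : lmodType k) (B : U -> V -> W) :
  bilin B -> linear (tlift B).
Proof.
move=> bB a x y; rewrite -[a *: x]/(tensor_scale a x).
by rewrite -[_ + y]/(tensor_add _ y) !tensorE.
Qed.

Lemma tens_bilin : bilin tens.
Proof.
split=> [v | u] a x y; apply: tensor_ext => W B bB;
  rewrite (tlift_linear bB) !tlift_tens //; case: bB => bl br.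
  exact: bl.
exact: br.
Qed.

Lemma tensZ (a b : k) (u : U) (v : V) :
  tens (a *: u) (b *: v) = (a * b) *: tens u v.
Proof.
have := scalable_linear (tens_bilin.1 (b *: v)) a u => /= ->.
by have := scalable_linear (tens_bilin.2 u) b v => /= ->; rewrite scalerA.
Qed.

Lemma tensor_sum (t : tensor) :
  t = \sum_(p <- repr (t : {eq_quot tens_eq})) tens p.1 p.2.
Proof.
rewrite -{1}[t](@reprK _ {eq_quot tens_eq}).
elim: (repr _) => [|[u v] s IH]; first by rewrite big_nil.
rewrite big_cons -IH; apply: tensor_ext => W B bB.
by rewrite tlift_add // tlift_tens // !tlift_pi // /feval big_cons.
Qed.

Lemma tlift_unique (W : lmodType k) (f g : {linear tensor -> W}) :
  (forall u v, f (tens u v) = g (tens u v)) -> f =1 g.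
Proof.
move=> fg t; rewrite (tensor_sum t) !linear_sum.
by apply: eq_bigr => p _; exact: fg.
Qed.

End TensorProduct.

Arguments tens {k U V} u v.
Arguments tlift {k U V W} B t.

Notation "U '\tensor' V" := (tensor U V)
  (at level 40, left associativity) : type_scope.
Notation "u ⊗ v" := (tens u v) (at level 40, left associativity) : ring_scope.

(* Sweedler sum: the sum of the [E] over any way of writing [t] as a sum of
   pure tensors x ⊗ y; [E] has to be bilinear in x and y. *)
Notation "\tsum_ ( x , y <- t ) E" := (tlift (fun x y => E) t)
  (at level 41, x name, y name, t at level 200, E at level 41,
   format "'[' \tsum_ ( x ,  y  <-  t ) '/  '  E ']'") : ring_scope.

Section SweedlerCalculus.
Variable k : fieldType.
Implicit Types U V W X : lmodType k.

Lemma eq_tlift U V W (B B' : U -> V -> W) (t : U \tensor V) :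
  (forall u v, B u v = B' u v) -> tlift B t = tlift B' t.
Proof. by move=> BB'; apply: eq_bigr => p _. Qed.

Lemma linear_tlift U V W X (f : {linear W -> X}) (B : U -> V -> W)
    (t : U \tensor V) :
  f (tlift B t) = \tsum_(u, v <- t) f (B u v).
Proof. exact: linear_sum. Qed.

Lemma tlift_comb U V W (a : k) (B B' : U -> V -> W) (t : U \tensor V) :
  \tsum_(u, v <- t) (a *: B u v + B' u v) = a *: tlift B t + tlift B' t.
Proof. by rewrite /tlift /feval big_split -scaler_sumr. Qed.

Lemma tlift_exchange U V U' V' W (B : U -> V -> U' -> V' -> W)
    (t : U \tensor V) (t' : U' \tensor V') :
  \tsum_(u, v <- t) \tsum_(u', v' <- t') B u v u' v' =
  \tsum_(u', v' <- t') \tsum_(u, v <- t) B u v u' v'.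
Proof. exact: exchange_big. Qed.

Lemma linear_is_tlift U V W (f : {linear U \tensor V -> W}) (t : U \tensor V) :
  f t = \tsum_(u, v <- t) f (u ⊗ v).
Proof. by rewrite [in LHS](tensor_sum t) linear_sum. Qed.

Lemma linear_param_tlift U V W X (B : X -> U -> V -> W) (t : U \tensor V) :
  (forall u v, linear (fun x => B x u v)) -> linear (fun x => tlift (B x) t).
Proof.
by move=> lB a x y; rewrite -tlift_comb; apply: eq_tlift => u v; exact: lB.
Qed.

Lemma linear_arg_tlift U V W X (B : U -> V -> W) (g : X -> U \tensor V) :
  bilin B -> linear g -> linear (fun x => tlift B (g x)).
Proof. by move=> bB lg a x y; rewrite lg (tlift_linear bB). Qed.

Lemma linear_tensl U V X (f : X -> U) (v : V) :
  linear f -> linear (fun x => f x ⊗ v).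
Proof. by move=> lf a x y; rewrite lf; exact: (tens_bilin U V).1. Qed.

Lemma linear_tensr U V X (u : U) (f : X -> V) :
  linear f -> linear (fun x => u ⊗ f x).
Proof. by move=> lf a x y; rewrite lf; exact: (tens_bilin U V).2. Qed.

Lemma linear_id U : linear (fun x : U => x).
Proof. by []. Qed.

End SweedlerCalculus.

HB.mixin Record Lmodule_isCoalgebra (k : fieldType) C of GRing.Lmodule k C := {
  comul : {linear C -> C \tensor C};
  counit : {linear C -> k^o};
  comulA : forall c : C,
    \tsum_(c1, c2 <- comul c) \tsum_(c11, c12 <- comul c1) (c11 ⊗ (c12 ⊗ c2)) =
    \tsum_(c1, c2 <- comul c) \tsum_(c21, c22 <- comul c2) (c1 ⊗ (c21 ⊗ c22));
  counitl : forall c : C, \tsum_(c1, c2 <- comul c) (counit c1 : k) *: c2 = c;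
  counitr : forall c : C, \tsum_(c1, c2 <- comul c) (counit c2 : k) *: c1 = c
}.

#[short(type="coalgType")]
HB.structure Definition Coalgebra (k : fieldType) :=
  {C of GRing.Lmodule k C & Lmodule_isCoalgebra k C}.

HB.mixin Record Algebra_isHopfAlgebra (k : fieldType) H
    of GRing.Algebra k H & Coalgebra k H := {
  comul1 : comul (1 : H) = 1 ⊗ 1;
  comulM : forall x y : H,
    comul (x * y) =
    \tsum_(x1, x2 <- comul x) \tsum_(y1, y2 <- comul y)
      ((x1 * y1) ⊗ (x2 * y2));
  counit1 : counit (1 : H) = 1 :> k;
  counitM : forall x y : H, counit (x * y) = (counit x : k) * counit y :> k;
  antipode : {linear H -> H};
  antipodel : forall h : H,
    \tsum_(h1, h2 <- comul h) (antipode h1 * h2) = (counit h : k) *: 1;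
  antipoder : forall h : H,
    \tsum_(h1, h2 <- comul h) (h1 * antipode h2) = (counit h : k) *: 1
}.

#[short(type="hopfAlgType")]
HB.structure Definition HopfAlgebra (k : fieldType) :=
  {H of GRing.Algebra k H & Coalgebra k H & Algebra_isHopfAlgebra k H}.

Definition cocommutative (k : fieldType) (C : coalgType k) : Prop :=
  forall c : C, \tsum_(c1, c2 <- comul c) (c2 ⊗ c1) = comul c.

Section CoalgebraTheory.
Variables (k : fieldType) (C : coalgType k).

Lemma coassoc (W : lmodType k) (T : C -> C -> C -> W) (c : C) :
  (forall y z, linear (fun x => T x y z)) ->
  (forall x z, linear (fun y => T x y z)) ->
  (forall x y, linear (T x y)) ->
  \tsum_(c1, c2 <- comul c) \tsum_(c11, c12 <- comul c1) T c11 c12 c2 =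
  \tsum_(c1, c2 <- comul c) \tsum_(c21, c22 <- comul c2) T c1 c21 c22.
Proof.
move=> T1 T2 T3.
have bT x : bilin (T x) by split=> [z|y]; [exact: T2|exact: T3].
pose F x (t : C \tensor C) := tlift (T x) t.
have bF : bilin F.
  split=> [t|x] a u v; last exact: (tlift_linear (bT x)).
  rewrite /F -tlift_comb; apply: eq_tlift => y z; exact: T1.
have lin_tF : linear (tlift F) by exact: tlift_linear.
pose f : {linear C \tensor (C \tensor C) -> W} :=
  HB.pack (tlift F) (GRing.isLinear.Build _ _ _ _ (tlift F) lin_tF).
have := congr1 f (comulA c); rewrite !linear_tlift => fE.
transitivity (\tsum_(c1, c2 <- comul c)
    f (\tsum_(c11, c12 <- comul c1) (c11 ⊗ (c12 ⊗ c2)))).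
  apply: eq_tlift => c1 c2; rewrite linear_tlift; apply: eq_tlift => x y.
  by rewrite /= tlift_tens // /F tlift_tens.
rewrite fE; apply: eq_tlift => c1 c2; rewrite linear_tlift.
by apply: eq_tlift => x y; rewrite /= tlift_tens // /F tlift_tens.
Qed.

End CoalgebraTheory.

Section TensorCoalgebra.
Variables (k : fieldType) (C D : coalgType k).

Definition pure_comul (c : C) (d : D) : (C \tensor D) \tensor (C \tensor D) :=
  \tsum_(c1, c2 <- comul c) \tsum_(d1, d2 <- comul d)
    ((c1 ⊗ d1) ⊗ (c2 ⊗ d2)).

Definition pure_counit (c : C) (d : D) : k^o := (counit c : k) * counit d.

Lemma pure_comul_bilin : bilin pure_comul.
Proof.
have bD (c1 c2 : C) : bilin (fun d1 d2 : D => (c1 ⊗ d1) ⊗ (c2 ⊗ d2)).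
  by split=> x; do ?[apply: linear_tensl|apply: linear_tensr]; exact: linear_id.
split=> [d|c]; last first.
  apply: linear_param_tlift => c1 c2; apply: linear_arg_tlift => //.
  exact: linearP.
apply: linear_arg_tlift; last exact: linearP.
split=> x; apply: linear_param_tlift => d1 d2;
  by do ?[apply: linear_tensl|apply: linear_tensr]; exact: linear_id.
Qed.

Lemma pure_counit_bilin : bilin pure_counit.
Proof.
split=> [d|c] a x y; rewrite /pure_counit linearP /=.
  by rewrite mulrDl -mulrA.
by rewrite mulrDr mulrCA.
Qed.

Definition tensor_comul : C \tensor D -> _ := tlift pure_comul.
Definition tensor_counit : C \tensor D -> k^o := tlift pure_counit.

HB.instance Definition _ := GRing.isLinear.Build k (C \tensor D) _ _
  tensor_comul (tlift_linear pure_comul_bilin).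
HB.instance Definition _ := GRing.isLinear.Build k (C \tensor D) _ _
  tensor_counit (tlift_linear pure_counit_bilin).

Lemma sweedler_tens (W : lmodType k)
    (B : C \tensor D -> C \tensor D -> W) (c : C) (d : D) :
  bilin B ->
  \tsum_(t1, t2 <- tensor_comul (c ⊗ d)) B t1 t2 =
  \tsum_(c1, c2 <- comul c) \tsum_(d1, d2 <- comul d)
    B (c1 ⊗ d1) (c2 ⊗ d2).
Proof.
move=> bB; rewrite /tensor_comul tlift_tens; last exact: pure_comul_bilin.
pose f : {linear (C \tensor D) \tensor (C \tensor D) -> W} :=
  HB.pack (tlift B) (GRing.isLinear.Build _ _ _ _ (tlift B) (tlift_linear bB)).
rewrite -[LHS]/(f _) linear_tlift; apply: eq_tlift => c1 c2.
by rewrite linear_tlift; apply: eq_tlift => d1 d2; exact: tlift_tens.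
Qed.

Lemma linear_eq_tens (W : lmodType k) (f g : C \tensor D -> W) :
  linear f -> linear g -> (forall c d, f (c ⊗ d) = g (c ⊗ d)) -> f =1 g.
Proof.
move=> lf lg.
exact: (tlift_unique (f := HB.pack f (GRing.isLinear.Build _ _ _ _ f lf))
                     (g := HB.pack g (GRing.isLinear.Build _ _ _ _ g lg))).
Qed.

Let linear_comul (X : coalgType k) : linear (@comul k X).
Proof. exact: linearP. Qed.

Let linear_tcomul : linear tensor_comul.
Proof. exact: linearP. Qed.

Lemma tensor_comulA (t : C \tensor D) :
  \tsum_(t1, t2 <- tensor_comul t) \tsum_(t11, t12 <- tensor_comul t1)
    (t11 ⊗ (t12 ⊗ t2)) =
  \tsum_(t1, t2 <- tensor_comul t) \tsum_(t21, t22 <- tensor_comul t2)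
    (t1 ⊗ (t21 ⊗ t22)).
Proof.
have bl (z : C \tensor D) : bilin (fun x y : C \tensor D => x ⊗ (y ⊗ z)).
  by split=> x; do ?[apply: linear_tensl|apply: linear_tensr]; exact: linear_id.
have br (z : C \tensor D) : bilin (fun x y : C \tensor D => z ⊗ (x ⊗ y)).
  by split=> x; do ?[apply: linear_tensl|apply: linear_tensr]; exact: linear_id.
have bL : bilin (fun t1 t2 : C \tensor D =>
    \tsum_(t11, t12 <- tensor_comul t1) (t11 ⊗ (t12 ⊗ t2))).
  split=> [z|z]; first exact: linear_arg_tlift.
  by apply: linear_param_tlift => x y; do ?apply: linear_tensr; exact: linear_id.
have bR : bilin (fun t1 t2 : C \tensor D =>
    \tsum_(t21, t22 <- tensor_comul t2) (t1 ⊗ (t21 ⊗ t22))).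
  split=> [z|z]; last exact: linear_arg_tlift.
  by apply: linear_param_tlift => x y; apply: linear_tensl; exact: linear_id.
apply: (linear_eq_tens (f := fun t => tlift _ (tensor_comul t))
                       (g := fun t => tlift _ (tensor_comul t))).
- exact: linear_arg_tlift.
- exact: linear_arg_tlift.
move=> c d; rewrite !sweedler_tens //.
pose T (c1 c2 c3 : C) (d1 d2 d3 : D) :=
  (c1 ⊗ d1) ⊗ ((c2 ⊗ d2) ⊗ (c3 ⊗ d3)).
transitivity (\tsum_(c1, c2 <- comul c) \tsum_(c11, c12 <- comul c1)
  \tsum_(d1, d2 <- comul d) \tsum_(d11, d12 <- comul d1)
    T c11 c12 c2 d11 d12 d2).
  apply: eq_tlift => c1 c2; rewrite -tlift_exchange; apply: eq_tlift => d1 d2.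
  by rewrite sweedler_tens.
transitivity (\tsum_(c1, c2 <- comul c) \tsum_(c11, c12 <- comul c1)
  \tsum_(d1, d2 <- comul d) \tsum_(d21, d22 <- comul d2)
    T c11 c12 c2 d1 d21 d22).
  do 2![apply: eq_tlift => ? ?].
  by apply: coassoc => ? ?; do ?[apply: linear_tensl|apply: linear_tensr];
    exact: linear_id.
rewrite (@coassoc _ _ _ (fun c1 c2 c3 => \tsum_(d1, d2 <- comul d)
   \tsum_(d21, d22 <- comul d2) T c1 c2 c3 d1 d21 d22)) => [|? ?|? ?|? ?];
  try by do 2![apply: linear_param_tlift => ? ?];
    do ?[apply: linear_tensl|apply: linear_tensr]; exact: linear_id.
apply: eq_tlift => c1 c2; rewrite tlift_exchange; apply: eq_tlift => d1 d2.
by rewrite sweedler_tens.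
Qed.

Lemma tensor_counitl (t : C \tensor D) :
  \tsum_(t1, t2 <- tensor_comul t) (tensor_counit t1 : k) *: t2 = t.
Proof.
have bL : bilin (fun t1 t2 : C \tensor D => (tensor_counit t1 : k) *: t2).
  split=> [z|z] a x y; last by rewrite /= scalerDr !scalerA [a * _]mulrC.
  by rewrite /= linearP scalerDl scalerA.
apply: (linear_eq_tens (f := fun t => tlift _ (tensor_comul t)) (g := id)).
- exact: linear_arg_tlift.
- exact: linear_id.
move=> c d; rewrite sweedler_tens // -{2}[c]counitl.
pose f : {linear C -> C \tensor D} := HB.pack (fun c : C => c ⊗ d)
  (GRing.isLinear.Build _ _ _ _ (fun c : C => c ⊗ d) ((tens_bilin C D).1 d)).
rewrite -[RHS]/(f _) linear_tlift; apply: eq_tlift => c1 c2.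
rewrite /= -{2}[d]counitl.
pose g : {linear D -> C \tensor D} := HB.pack (fun d : D => ((counit c1 : k) *: c2) ⊗ d)
  (GRing.isLinear.Build _ _ _ _ _ ((tens_bilin C D).2 ((counit c1 : k) *: c2))).
rewrite -[RHS]/(g _) linear_tlift; apply: eq_tlift => d1 d2.
rewrite /= /tensor_counit tlift_tens; last exact: pure_counit_bilin.
by rewrite tensZ.
Qed.

Lemma tensor_counitr (t : C \tensor D) :
  \tsum_(t1, t2 <- tensor_comul t) (tensor_counit t2 : k) *: t1 = t.
Proof.
have bL : bilin (fun t1 t2 : C \tensor D => (tensor_counit t2 : k) *: t1).
  split=> [z|z] a x y; first by rewrite /= scalerDr !scalerA [a * _]mulrC.
  by rewrite /= linearP scalerDl scalerA.
apply: (linear_eq_tens (f := fun t => tlift _ (tensor_comul t)) (g := id)).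
- exact: linear_arg_tlift.
- exact: linear_id.
move=> c d; rewrite sweedler_tens // -{2}[c]counitr.
pose f : {linear C -> C \tensor D} := HB.pack (fun c : C => c ⊗ d)
  (GRing.isLinear.Build _ _ _ _ (fun c : C => c ⊗ d) ((tens_bilin C D).1 d)).
rewrite -[RHS]/(f _) linear_tlift; apply: eq_tlift => c1 c2.
rewrite /= -{2}[d]counitr.
pose g : {linear D -> C \tensor D} := HB.pack (fun d : D => ((counit c2 : k) *: c1) ⊗ d)
  (GRing.isLinear.Build _ _ _ _ _ ((tens_bilin C D).2 ((counit c2 : k) *: c1))).
rewrite -[RHS]/(g _) linear_tlift; apply: eq_tlift => d1 d2.
rewrite /= /tensor_counit tlift_tens; last exact: pure_counit_bilin.
by rewrite tensZ.
Qed.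

HB.instance Definition _ := Lmodule_isCoalgebra.Build k (C \tensor D)
  tensor_comulA tensor_counitl tensor_counitr.

End TensorCoalgebra.

Section Convolution.
Variables (k : fieldType) (C : coalgType k) (A : algType k).
Implicit Types f g e : {linear C -> A}.

Definition conv f g (c : C) : A := \tsum_(c1, c2 <- comul c) (f c1 * g c2).

Lemma conv_linear f g : linear (conv f g).
Proof.
apply: linear_arg_tlift; last exact: linearP.
split=> z a x y; rewrite /= linearP.
  by rewrite mulrDl scalerAl.
by rewrite mulrDr scalerAr.
Qed.

HB.instance Definition _ f g :=
  GRing.isLinear.Build k C A _ (conv f g) (conv_linear f g).

Definition conv_central_idempotent e : Prop :=
  conv e e =1 e /\ forall f, conv e f =1 conv f e.

(* the two-sided ideal <e>: all finite sums of products f * e * g *)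
Definition in_conv_ideal e f : Prop :=
  exists s : seq ({linear C -> A} * {linear C -> A}),
    forall c : C, f c = \sum_(p <- s) conv (conv p.1 e) p.2 c.

(* For a central idempotent e, the ideal <e> is a ring with unit e. *)
Definition conv_ideal_invertible e f : Prop :=
  in_conv_ideal e f /\
  exists f' : {linear C -> A},
    [/\ in_conv_ideal e f', conv f f' =1 e & conv f' f =1 e].

End Convolution.

Section PartialActions.
Variables (k : fieldType) (H : hopfAlgType k) (A : algType k).
Variables (act : {linear H \tensor A -> A}) (omega : {linear H \tensor H -> A}).

Local Notation "h ▷ a" := (act (h ⊗ a)) (at level 40, left associativity).
Local Notation "'ω' ( h , l )" := (omega (h ⊗ l)) (format "'ω' ( h ,  l )").

Record partial_action : Prop := PartialAction {
  PA1 : forall a : A, 1 ▷ a = a;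
  PA2 : forall (h : H) (a b : A),
    h ▷ (a * b) = \tsum_(h1, h2 <- comul h) ((h1 ▷ a) * (h2 ▷ b));
  PA3 : forall (h l : H) (a : A),
    h ▷ (l ▷ a) = \tsum_(h1, h2 <- comul h) ((h1 ▷ 1) * ((h2 * l) ▷ a))
}.

Record twisted_partial_action : Prop := TwistedPartialAction {
  TPA1 : forall a : A, 1 ▷ a = a;
  TPA2 : forall (h : H) (a b : A),
    h ▷ (a * b) = \tsum_(h1, h2 <- comul h) ((h1 ▷ a) * (h2 ▷ b));
  TPA3 : forall (h l : H) (a : A),
    \tsum_(h1, h2 <- comul h) \tsum_(l1, l2 <- comul l)
      ((h1 ▷ (l1 ▷ a)) * ω(h2, l2)) =
    \tsum_(h1, h2 <- comul h) \tsum_(l1, l2 <- comul l)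
      (ω(h1, l1) * ((h2 * l2) ▷ a));
  TPA4 : forall h l : H,
    ω(h, l) =
    \tsum_(h1, h2 <- comul h) \tsum_(l1, l2 <- comul l)
      (ω(h1, l1) * ((h2 * l2) ▷ 1))
}.

Definition pure_e12 (h l : H) : A := (counit l : k) *: (h ▷ 1).
Definition pure_e2 (h l : H) : A := (h * l) ▷ 1.

Lemma pure_e12_bilin : bilin pure_e12.
Proof.
split=> z a x y; rewrite /pure_e12.
  rewrite (linear_tensl 1 (@linear_id _ H)) linearP.
  by rewrite scalerDr scalerA [_ * a]mulrC -scalerA.
by rewrite linearP scalerDl -scalerA.
Qed.

Lemma pure_e2_bilin : bilin pure_e2.
Proof.
split=> z a x y; rewrite /pure_e2 /= ?mulrDl ?mulrDr -?scalerAl -?scalerAr;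
  by rewrite (linear_tensl 1 (@linear_id _ H)) linearP.
Qed.

Definition e12 : H \tensor H -> A := tlift pure_e12.
Definition e2 : H \tensor H -> A := tlift pure_e2.

HB.instance Definition _ := GRing.isLinear.Build k (H \tensor H) A _
  e12 (tlift_linear pure_e12_bilin).
HB.instance Definition _ := GRing.isLinear.Build k (H \tensor H) A _
  e2 (tlift_linear pure_e2_bilin).

Lemma e12E (h l : H) : e12 (h ⊗ l) = (counit l : k) *: (h ▷ 1).
Proof. exact: (tlift_tens _ _ pure_e12_bilin). Qed.

Lemma e2E (h l : H) : e2 (h ⊗ l) = (h * l) ▷ 1.
Proof. exact: (tlift_tens _ _ pure_e2_bilin). Qed.

Record symmetric_twisted_partial_action : Prop :=
  SymmetricTwistedPartialAction {
  symm_twisted : twisted_partial_action;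
  symm_e12 : conv_central_idempotent e12;
  symm_e2 : conv_central_idempotent e2;
  symm_cocycle : forall h l m : H,
    \tsum_(h1, h2 <- comul h) \tsum_(l1, l2 <- comul l)
      \tsum_(m1, m2 <- comul m)
        ((h1 ▷ ω(l1, m1)) * ω(h2, l2 * m2)) =
    \tsum_(h1, h2 <- comul h) \tsum_(l1, l2 <- comul l)
      (ω(h1, l1) * ω(h2 * l2, m));
  symm_invertible : conv_ideal_invertible (conv e12 e2) omega;
  symm_act_act1 : forall h l : H,
    h ▷ (l ▷ 1) = \tsum_(h1, h2 <- comul h) ((h1 ▷ 1) * ((h2 * l) ▷ 1))
}.

End PartialActions.

(* Main.v *)
From HB Require Import structures.
Require Import Defs.
From mathcomp Require Import all_boot all_algebra.

Set Implicit Arguments.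
Unset Strict Implicit.
Unset Printing Implicit Defensive.

Import GRing.Theory.
Local Open Scope ring_scope.

(** Fix [a : A] and compare the two linear maps H ⊗ H -> A

      F (h ⊗ l) = h ▷ (l ▷ a)     and     G (h ⊗ l) = (h l) ▷ a.

    Axiom (PA3) says that F = e12 * G for the convolution product.

    As H is cocommutative, so is the coalgebra H ⊗ H, and as A is commutative
    the convolution algebra Hom (H ⊗ H, A) is commutative ([convC]).  The
    twisted module axiom (TPA3) reads F * ω = ω * G; in a commutative algebra
    ω can be moved across G, and multiplying by its inverse in the ideal of
    unit e12 * e2 leaves

      F * (e12 * e2) = G * (e12 * e2).

    It remains to absorb idempotents.  Writing a as a 1 or 1 a and using the
    multiplicativity (TPA2), one gets e2 * G = G ([conv_e2_act_mul]) and, since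
    the condition on h ▷ (l ▷ 1) says exactly that
    (e12 * e2) (h ⊗ l) = h ▷ (l ▷ 1), also F * (e12 * e2) = F
    ([conv_act_act_e12e2]).  Therefore F = F * e12 * e2 = e12 * e2 * G
    = e12 * G. *)

(** * Sweedler sums *)

(** Sweedler sums over a map into a tensor product may be rewritten along
    any equality of tensors written as Sweedler sums; this is how identities
    such as cocommutativity and [comulM] are used under a bilinear [B]. *)
Lemma tlift_sweedler (k : fieldType) (U V U' V' W : lmodType k)
    (B : U -> V -> W) (f : U' -> V' -> U \tensor V) (t : U' \tensor V') :
  bilin B -> tlift B (tlift f t) = \tsum_(x, y <- t) tlift B (f x y).
Proof.
move=> bB.
pose g : {linear U \tensor V -> W} :=
  HB.pack (tlift B) (GRing.isLinear.Build _ _ _ _ (tlift B) (tlift_linear bB)).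
exact: (linear_tlift g).
Qed.

Lemma sweedler_flip (k : fieldType) (C : coalgType k) (W : lmodType k)
    (B : C -> C -> W) (c : C) :
  cocommutative C -> bilin B ->
  \tsum_(c1, c2 <- comul c) B c2 c1 = \tsum_(c1, c2 <- comul c) B c1 c2.
Proof.
move=> cC bB; rewrite -[in RHS](cC c) tlift_sweedler //.
by apply: eq_tlift => x y; rewrite tlift_tens.
Qed.

Lemma sweedler_mul (k : fieldType) (H : hopfAlgType k) (W : lmodType k)
    (B : H -> H -> W) (x y : H) :
  bilin B ->
  \tsum_(z1, z2 <- comul (x * y)) B z1 z2 =
  \tsum_(x1, x2 <- comul x) \tsum_(y1, y2 <- comul y) B (x1 * y1) (x2 * y2).
Proof.
move=> bB; rewrite comulM tlift_sweedler //; apply: eq_tlift => x1 x2.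
by rewrite tlift_sweedler //; apply: eq_tlift => y1 y2; rewrite tlift_tens.
Qed.

Lemma cocommutative_tensor (k : fieldType) (C D : coalgType k) :
  cocommutative C -> cocommutative D -> cocommutative (C \tensor D).
Proof.
move=> cC cD.
have bT (X Y : lmodType k) : bilin (fun x y : X \tensor Y => y ⊗ x).
  by split=> z; do ?[apply: linear_tensl|apply: linear_tensr]; exact: linear_id.
apply: linear_eq_tens.
- apply: linear_arg_tlift; last exact: linearP.
  by split=> z; do ?[apply: linear_tensl|apply: linear_tensr]; exact: linear_id.
- exact: linearP.
move=> c d; rewrite sweedler_tens; last first.
  by split=> z; do ?[apply: linear_tensl|apply: linear_tensr]; exact: linear_id.
rewrite [RHS](tlift_tens _ _ (pure_comul_bilin C D)) /pure_comul.
rewrite (sweedler_flip (B := fun c1 c2 => \tsum_(d1, d2 <- comul d)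
  ((c1 ⊗ d2) ⊗ (c2 ⊗ d1))) c cC); last first.
  by split=> z; apply: linear_param_tlift => d1 d2;
    do ?[apply: linear_tensl|apply: linear_tensr]; exact: linear_id.
apply: eq_tlift => c1 c2.
apply: (sweedler_flip (B := fun d1 d2 => (c1 ⊗ d1) ⊗ (c2 ⊗ d2))) => //.
by split=> z; do ?[apply: linear_tensl|apply: linear_tensr]; exact: linear_id.
Qed.

(** * The convolution algebra *)

Lemma mul_bilin (k : fieldType) (U V : lmodType k) (A : algType k)
    (f : {linear U -> A}) (g : {linear V -> A}) :
  bilin (fun x y => f x * g y).
Proof.
split=> z a x y; rewrite /= linearP.
  by rewrite mulrDl scalerAl.
by rewrite mulrDr scalerAr.
Qed.

Section Convolution.
Variables (k : fieldType) (C : coalgType k).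

Lemma eq_conv (A : algType k) (f f' g g' : {linear C -> A}) :
  f =1 f' -> g =1 g' -> conv f g =1 conv f' g'.
Proof. by move=> ff gg c; apply: eq_tlift => x y; rewrite ff gg. Qed.

Lemma convA (A : algType k) (f g h : {linear C -> A}) :
  conv f (conv g h) =1 conv (conv f g) h.
Proof.
move=> c; rewrite /conv.
transitivity (\tsum_(c1, c2 <- comul c) \tsum_(c21, c22 <- comul c2)
   (f c1 * (g c21 * h c22))).
  by apply: eq_tlift => c1 c2; exact: mulr_sumr.
rewrite -(@coassoc _ _ _ (fun x y z => f x * (g y * h z))); first last.
- by move=> x y a u v; rewrite linearP !mulrDr -!scalerAr.
- by move=> x z a u v; rewrite linearP mulrDl mulrDr -scalerAl -scalerAr.
- by move=> y z a u v; rewrite linearP mulrDl -scalerAl.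
apply: eq_tlift => c1 c2; rewrite [RHS]mulr_suml.
by apply: eq_bigr => p _; rewrite mulrA.
Qed.

(** The twist of the arguments is undone on the source by cocommutativity and
    on the target by commutativity. *)
Lemma convC (A : comAlgType k) (f g : {linear C -> A}) :
  cocommutative C -> conv f g =1 conv g f.
Proof.
move=> cC c; rewrite /conv -(sweedler_flip _ cC); last exact: mul_bilin.
by apply: eq_tlift => x y; rewrite mulrC.
Qed.

End Convolution.

Lemma conv_tens (k : fieldType) (C D : coalgType k) (A : algType k)
    (f g : {linear C \tensor D -> A}) (c : C) (d : D) :
  conv f g (c ⊗ d) =
  \tsum_(c1, c2 <- comul c) \tsum_(d1, d2 <- comul d)
    (f (c1 ⊗ d1) * g (c2 ⊗ d2)).
Proof. exact: (sweedler_tens _ _ (mul_bilin f g)). Qed.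

(** * Maps built from the action *)

Section Action.
Variables (k : fieldType) (H : hopfAlgType k) (A : algType k).
Variable act : {linear H \tensor A -> A}.

Local Notation "h ▷ a" := (act (h ⊗ a)) (at level 40, left associativity).

Lemma act_linear_l (a : A) : linear (fun h : H => h ▷ a).
Proof. by move=> c x y; rewrite (linear_tensl a (@linear_id _ H)) linearP. Qed.

Lemma act_linear_r (h : H) : linear (fun a : A => h ▷ a).
Proof. by move=> c x y; rewrite (linear_tensr h (@linear_id _ A)) linearP. Qed.

Lemma act_tlift (U V : lmodType k) (h : H) (B : U -> V -> A)
    (t : U \tensor V) : h ▷ tlift B t = \tsum_(x, y <- t) (h ▷ B x y).
Proof.
pose f : {linear A -> A} :=
  HB.pack (fun a : A => h ▷ a) (GRing.isLinear.Build _ _ _ _ _ (act_linear_r h)).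
exact: (linear_tlift f).
Qed.

Lemma act_act_bilin (a : A) : bilin (fun h l : H => h ▷ (l ▷ a)).
Proof.
split=> z c x y; first exact: act_linear_l.
by rewrite /= act_linear_l act_linear_r.
Qed.

Lemma act_mul_bilin (a : A) : bilin (fun h l : H => (h * l) ▷ a).
Proof.
by split=> z c x y;
  rewrite /= ?mulrDl ?mulrDr -?scalerAl -?scalerAr act_linear_l.
Qed.

Definition act_act (a : A) : H \tensor H -> A :=
  tlift (fun h l : H => h ▷ (l ▷ a)).
Definition act_mul (a : A) : H \tensor H -> A :=
  tlift (fun h l : H => (h * l) ▷ a).

HB.instance Definition _ a := GRing.isLinear.Build k (H \tensor H) A _
  (act_act a) (tlift_linear (act_act_bilin a)).
HB.instance Definition _ a := GRing.isLinear.Build k (H \tensor H) A _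
  (act_mul a) (tlift_linear (act_mul_bilin a)).

Lemma act_actE (a : A) (h l : H) : act_act a (h ⊗ l) = h ▷ (l ▷ a).
Proof. exact: (tlift_tens _ _ (act_act_bilin a)). Qed.

Lemma act_mulE (a : A) (h l : H) : act_mul a (h ⊗ l) = (h * l) ▷ a.
Proof. exact: (tlift_tens _ _ (act_mul_bilin a)). Qed.

(** The factor [counit l1] of [e12] collapses the Sweedler sum of [l]. *)
Lemma conv_e12 (g : {linear H \tensor H -> A}) (h l : H) :
  conv (e12 act) g (h ⊗ l) =
  \tsum_(h1, h2 <- comul h) ((h1 ▷ 1) * g (h2 ⊗ l)).
Proof.
rewrite conv_tens; apply: eq_tlift => h1 h2; rewrite -{2}[l]counitl.
have lin : linear (fun x : H => (h1 ▷ 1) * g (h2 ⊗ x)).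
  move=> c x y; rewrite (linear_tensr h2 (@linear_id _ H)) linearP.
  by rewrite mulrDr -scalerAr.
pose f : {linear H -> A} := HB.pack (fun x : H => (h1 ▷ 1) * g (h2 ⊗ x))
  (GRing.isLinear.Build _ _ _ _ _ lin).
rewrite -[RHS]/(f _) linear_tlift; apply: eq_tlift => l1 l2.
by rewrite linearZ /= e12E -scalerAl.
Qed.

Hypothesis act_prod : forall (h : H) (a b : A),
  h ▷ (a * b) = \tsum_(h1, h2 <- comul h) ((h1 ▷ a) * (h2 ▷ b)).

(** As [comul] is multiplicative, the product expands to (h l) ▷ (1 a) by the
    compatibility of the action with products. *)
Lemma conv_e2_act_mul (a : A) : conv (e2 act) (act_mul a) =1 act_mul a.
Proof.
apply: linear_eq_tens => [||h l]; [exact: linearP | exact: linearP |].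
have bB : bilin (fun x y : H => (x ▷ 1) * (y ▷ a)).
  split=> z c x y; rewrite /= act_linear_l.
    by rewrite mulrDl -scalerAl.
  by rewrite mulrDr -scalerAr.
rewrite conv_tens act_mulE -[a in RHS]mul1r act_prod sweedler_mul //.
by do 2![apply: eq_tlift => ? ?]; rewrite /= e2E act_mulE.
Qed.

(** Compatibility of the action with products, used for [l] and then for [h],
    makes [act_act] multiplicative from A to the convolution algebra. *)
Lemma conv_act_act (a b : A) (h l : H) :
  conv (act_act a) (act_act b) (h ⊗ l) = h ▷ (l ▷ (a * b)).
Proof.
rewrite conv_tens act_prod act_tlift tlift_exchange; apply: eq_tlift => l1 l2.
by rewrite act_prod; apply: eq_tlift => h1 h2; rewrite /= !act_actE.
Qed.

Hypothesis act_act1 : forall h l : H,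
  h ▷ (l ▷ 1) = \tsum_(h1, h2 <- comul h) ((h1 ▷ 1) * ((h2 * l) ▷ 1)).

Lemma conv_e12_e2 : conv (e12 act) (e2 act) =1 act_act 1.
Proof.
apply: linear_eq_tens => [||h l]; [exact: linearP | exact: linearP |].
rewrite conv_e12 act_actE act_act1; apply: eq_tlift => h1 h2.
by rewrite /= e2E.
Qed.

Lemma conv_act_act_e12e2 (a : A) :
  conv (act_act a) (conv (e12 act) (e2 act)) =1 act_act a.
Proof.
apply: linear_eq_tens => [||h l]; [exact: linearP | exact: linearP |].
rewrite (eq_conv _ conv_e12_e2 (f' := act_act a)) //.
by rewrite conv_act_act mulr1 act_actE.
Qed.

End Action.

(** * Partial actions *)

Theorem proposition5p5 (k : fieldType) (H : hopfAlgType k) (A : comAlgType k)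
    (act : {linear H \tensor A -> A}) (omega : {linear H \tensor H -> A})
    (cocommH : cocommutative H)
    (symA : symmetric_twisted_partial_action act omega) :
  partial_action act.
Proof.
have [[act1 actM twist _] _ _ _ inv_omega act_act1] := symA.
have [_ [omega' [_ omegaK _]]] := inv_omega.
split=> // h l a.
pose F := act_act act a; pose G := act_mul act a.
have cHH : cocommutative (H \tensor H) by exact: cocommutative_tensor.
have FG : conv F omega =1 conv omega G.
  apply: linear_eq_tens => [||x y]; [exact: linearP | exact: linearP |].
  rewrite !conv_tens.
  transitivity (\tsum_(x1, x2 <- comul x) \tsum_(y1, y2 <- comul y)
     (act (x1 ⊗ act (y1 ⊗ a)) * omega (x2 ⊗ y2))).
    by do 2![apply: eq_tlift => ? ?]; rewrite /= act_actE.
  by rewrite twist; do 2![apply: eq_tlift => ? ?]; rewrite /= act_mulE.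
have FE : F =1 conv (e12 act) G.
  move=> t; rewrite -[LHS](conv_act_act_e12e2 actM act_act1).
  (* F * e12 * e2 = F * ω * ω' = G * ω * ω' = G * e12 * e2 = e12 * (e2 * G). *)
  transitivity (conv F (conv omega omega') t).
    by apply: eq_conv => // u; rewrite /= omegaK.
  rewrite convA.
  transitivity (conv (conv G omega) omega' t).
    by apply: eq_conv => // u; rewrite /= FG convC.
  rewrite -convA.
  transitivity (conv G (conv (e12 act) (e2 act)) t).
    exact: eq_conv.
  rewrite convC // -convA.
  by apply: eq_conv => //; exact: conv_e2_act_mul.
rewrite -(act_actE act) -/F FE conv_e12; apply: eq_tlift => h1 h2.
by rewrite /= act_mulE.
Qed.
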